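(* If the law $\mathbb{P}_{\boldsymbol{w}}$ of the disturbance is log-concave and $\mathcal{O}(\overline{0})$ is convex and compact, then for every $\alpha>0$ and every $\tau\in\{1,\dots,N\}$ the $\alpha$-probabilistic occupied set $$\mathrm{PrOccupySet}_P(\alpha;\tau)=\{\overline{y}\in\mathbb{R}^n:\phi_{\boldsymbol{x}}(\overline{y};\tau)\ge\alpha\}$$ is convex and compact.
   Context: DPV system (discrete-time affine parameter-varying stochastic system). Fix $N,n,m,p,l\ge 1$, a finite set $\mathcal{P}\subset\mathbb{R}^l$ and maps $A:\mathcal{P}\to\mathbb{R}^{n\times n}$, $B:\mathcal{P}\to\mathbb{R}^{n\times m}$, $F:\mathcal{P}\to\mathbb{R}^{n\times p}$. For $t=0,\dots,N-1$, $$\boldsymbol{x}_{t+1}=A(\overline\lambda_t)\boldsymbol{x}_t+B(\overline\lambda_t)\overline{u}_t+F(\overline\lambda_t)\boldsymbol{w}_t,$$ where $\boldsymbol{x}_0=\overline{x}_0\in\mathbb{R}^n$, the parameters $\overline\lambda_t\in\mathcal{P}$ and the inputs $\overline{u}_t\in\mathbb{R}^m$ are known and deterministic, and $\boldsymbol{w}_0,\dots,\boldsymbol{w}_{N-1}$ are IID random vectors in $\mathbb{R}^p$ with law $\mathbb{P}_{\boldsymbol{w}}$ having a density. Obstacle: let $h_{\mathrm{obs}}:\mathbb{R}^n\to\mathbb{R}$ be Borel and $\mathcal{O}(\overline{c})=\{\overline{z}\in\mathbb{R}^n:h_{\mathrm{obs}}(\overline{z}-\overline{c})\ge0\}$ for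 $\overline{c}\in\mathbb{R}^n$; the shape $\mathcal{O}(\overline{0})$ is a Borel set of non-zero Lebesgue measure. The probabilistic occupancy function is $$\phi_{\boldsymbol{x}}(\overline{y};\tau)=\mathbb{P}\{\boldsymbol{x}_\tau\in\{\overline{z}\in\mathbb{R}^n:\overline{y}\in\mathcal{O}(\overline{z})\}\}.$$ A probability measure $\mathbb{P}$ is log-concave if for all (non-empty) convex Borel sets $\mathcal{G}_A,\mathcal{G}_B$ and $\zeta\in[0,1]$, $\mathbb{P}(\zeta\mathcal{G}_A\oplus(1-\zeta)\mathcal{G}_B)\ge\mathbb{P}(\mathcal{G}_A)^\zeta\,\mathbb{P}(\mathcal{G}_B)^{1-\zeta}$, where $\oplus$ is the Minkowski sum. *)

(* Defs.v *)
From HB Require Import structures.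
From mathcomp Require Import all_boot all_order all_algebra.
From mathcomp Require Import all_classical all_reals all_analysis.
From mathcomp Require Import measurable_realfun.

Set Implicit Arguments.
Unset Strict Implicit.
Unset Printing Implicit Defensive.

Import Order.TTheory GRing.Theory Num.Theory.
Import numFieldNormedType.Exports.

Local Open Scope classical_set_scope.
Local Open Scope ring_scope.

Definition open_mx (R : realType) m n : set (set 'M[R]_(m, n)) := open.

(* The Borel sigma-algebra of R^(m x n). *)
HB.instance Definition _ (R : realType) m n :=
  @isMeasurable.Build (sigma_display (@open_mx R m n)) 'M[R]_(m, n)
    <<s @open_mx R m n >> (@sigma_algebra0 _ setT _) (@sigma_algebraC _ _)
    (@sigma_algebra_bigcup _ setT _).

Section borel_matrix.
Context (R : realType).

Lemma open_measurable_mx m n (U : set 'M[R]_(m, n)) : open U -> measurable U.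
Proof. exact: sub_sigma_algebra. Qed.

Lemma open_bigcup_rat_ball m n (U : set 'M[R]_(m, n)) : open U ->
  U = \bigcup_(qk in [set qk : 'M[rat]_(m, n) * nat |
                       ball (map_mx ratr qk.1 : 'M[R]_(m, n)) qk.2.+1%:R^-1
                         `<=` U])
        ball (map_mx ratr qk.1 : 'M[R]_(m, n)) qk.2.+1%:R^-1.
Proof.
move=> oU; apply/seteqP; split => [x Ux|x [qk qkU /qkU]//].
have /nbhs_ballP[e /= e0 eU] : nbhs x U by exact: open_nbhs_nbhs.
have [k ke] : exists k, k.+1%:R^-1 < e / 2 :> R.
  have e20 : 0 < e / 2 by rewrite divr_gt0.
  have [k _ ke] := near_infty_natSinv_lt (PosNum e20).
  by exists k; exact: (ke k (leqnn k)).
have k0 : 0 < k.+1%:R^-1 :> R by rewrite invr_gt0.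
have xq i j : exists q : rat, `|x i j - ratr q| < k.+1%:R^-1.
  have /rat_in_itvoo[q] : x i j - k.+1%:R^-1 < x i j + k.+1%:R^-1.
    by rewrite ltrD2l (lt_trans _ k0)// oppr_lt0.
  by rewrite in_itv/= => qx; exists q; rewrite ltr_distlC.
have bx : ball (map_mx ratr (\matrix_(i, j) projT1 (cid (xq i j)))
    : 'M[R]_(m, n)) k.+1%:R^-1 x.
  split=> // i j; rewrite !mxE; case: (cid _) => q /= qx.
  by rewrite -ball_normE/= distrC.
exists (\matrix_(i, j) projT1 (cid (xq i j)), k) => //= y qy.
apply: eU; have := ball_triangle (ball_sym bx) qy.
by apply: le_ball; rewrite (splitr e) ltW// ltrD.
Qed.

Lemma measurable_fun_mx d (T : measurableType d) m n (f : T -> 'M[R]_(m, n)) :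
  (forall i j, measurable_fun setT (fun t => f t i j : R)) ->
  measurable_fun setT f.
Proof.
move=> mf; apply: (@measurability _ _ _ _ _ f (@open_mx R m n)) => //.
move=> _ [U oU <-]; rewrite setTI (open_bigcup_rat_ball oU) preimage_bigcup.
rewrite bigcup_mkcond; apply: countable_bigcupT_measurable => //= qk.
case: ifPn => // _.
have -> : f @^-1` ball (map_mx ratr qk.1 : 'M[R]_(m, n)) qk.2.+1%:R^-1 =
  \bigcap_(i in [set: 'I_m]) \bigcap_(j in [set: 'I_n])
    (fun t => f t i j : R) @^-1`
       ball (ratr (qk.1 i j) : R) qk.2.+1%:R^-1.
  apply/seteqP; split=> [t [_ qt] i _ j _|t qt].
    by have := qt i j; rewrite mxE.
  by split=> [|i j]; [rewrite invr_gt0|rewrite mxE; exact: (qt i I j I)].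
apply: fin_bigcap_measurable => // i _; apply: fin_bigcap_measurable => // j _.
rewrite -[X in measurable X]setTI; apply: mf => //.
exact: measurable_ball.
Qed.

Lemma measurable_coord_mx m n (i : 'I_m) (j : 'I_n) :
  measurable_fun setT (fun M : 'M[R]_(m, n) => M i j : R).
Proof.
apply: (measurability (@RGenOpens.G R)).
  exact: RGenOpens.measurableE.
move=> _ [_ [x [y ->]] <-]; rewrite setTI; apply: open_measurable_mx.
apply: open_comp; last exact: interval_open.
by move=> M _; exact: coord_continuous.
Qed.

Definition cons_cV n (v : measurableTypeR R * 'cV[R]_n) : 'cV[R]_n.+1 :=
  col_mx (v.1 : R)%:M v.2.

Lemma measurable_cons_cV n : measurable_fun setT (@cons_cV n).
Proof.
apply: measurable_fun_mx => i j; rewrite /cons_cV.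
rewrite (_ : (fun v => _) = fun v : measurableTypeR R * 'cV[R]_n =>
    match fintype.split (i : 'I_(1 + n)) with
    | inl _ => v.1 : R
    | inr k => v.2 k j
    end); last first.
  apply/funext => v; rewrite mxE; case: fintype.split => // k.
  by rewrite !mxE !ord1.
case: fintype.split => [_|k]; first exact: measurable_fst.
apply: (measurableT_comp (measurable_coord_mx k j)).
exact: measurable_snd.
Qed.

Definition uncons_cV n (x : 'cV[R]_n.+1) : measurableTypeR R * 'cV[R]_n :=
  ((x : 'cV[R]_(1 + n)) ord0 ord0, dsubmx (x : 'cV[R]_(1 + n))).

Lemma measurable_uncons_cV n : measurable_fun setT (@uncons_cV n).
Proof.
apply/measurable_fun_pair; first exact: (@measurable_coord_mx n.+1 1).
apply: measurable_fun_mx => i j.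
rewrite [X in measurable_fun _ X](_ : _ =
  fun M : 'cV[R]_n.+1 => M (rshift 1 i) j : R).
  exact: measurable_coord_mx.
by apply/funext => M; rewrite mxE.
Qed.

Lemma cons_cVK n : cancel (@cons_cV n) (@uncons_cV n).
Proof.
move=> [a v]; rewrite /uncons_cV /cons_cV /= col_mxKd mxE.
by case: fintype.splitP => // k _; rewrite !ord1 mxE eqxx mulr1n.
Qed.

Section lebesgue_cons.
Local Open Scope ereal_scope.
Context n (mu : {sigma_finite_measure set 'cV[R]_n -> \bar R}).

Definition lebesgue_cons : set 'cV[R]_n.+1 -> \bar R :=
  pushforward (@lebesgue_measure R \x mu) (@cons_cV n).

Let lebesgue_cons0 : lebesgue_cons set0 = 0.
Proof. by rewrite /lebesgue_cons /pushforward preimage_set0 measure0. Qed.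

Let lebesgue_cons_ge0 A : 0 <= lebesgue_cons A.
Proof. by rewrite /lebesgue_cons /pushforward; exact: measure_ge0. Qed.

Let lebesgue_cons_sigma_additive : semi_sigma_additive lebesgue_cons.
Proof.
move=> F mF tF mUF; rewrite /lebesgue_cons /pushforward preimage_bigcup.
have mc k : measurable (@cons_cV n @^-1` F k).
  by rewrite -[X in measurable X]setTI; exact: measurable_cons_cV.
apply: measure_semi_sigma_additive => //; last exact: bigcupT_measurable.
apply/trivIsetP => /= i j _ _ ij; rewrite -preimage_setI.
by move/trivIsetP : tF => /(_ _ _ _ _ ij) ->//; rewrite preimage_set0.
Qed.

HB.instance Definition _ := isMeasure.Build _ _ _ lebesgue_cons
  lebesgue_cons0 lebesgue_cons_ge0 lebesgue_cons_sigma_additive.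

Let lebesgue_cons_sigma_finite : sigma_finite setT lebesgue_cons.
Proof.
have /sigma_finiteP[F [TF ndF Foo]] := sigma_finiteT (@lebesgue_measure R).
have /sigma_finiteP[G [TG ndG Goo]] := sigma_finiteT mu.
exists (fun k => @uncons_cV n @^-1` (F k `*` G k)).
  rewrite -preimage_bigcup (_ : \bigcup_k _ = setT) ?preimage_setT//.
  rewrite -subTset => -[x y] _.
  have [k _ Fx] : (\bigcup_k F k) x by rewrite -TF.
  have [j _ Gy] : (\bigcup_k G k) y by rewrite -TG.
  exists (maxn k j) => //; split => /=.
    by move: x Fx; exact/subsetPset/ndF/leq_maxl.
  by move: y Gy; exact/subsetPset/ndG/leq_maxr.
move=> k; have [mF Fk] := Foo k; have [mG Gk] := Goo k; split.
  by rewrite -[X in measurable X]setTI; apply: measurable_uncons_cV => //;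
    exact: measurableX.
rewrite /lebesgue_cons /pushforward -comp_preimage.
rewrite (_ : _ \o _ = id) ?preimage_id; last first.
  by apply/funext => v /=; rewrite cons_cVK.
by rewrite product_measure1E// lte_mul_pinfty// ge0_fin_numE.
Qed.

HB.instance Definition _ := Measure_isSigmaFinite.Build _ _ _ lebesgue_cons
  lebesgue_cons_sigma_finite.

End lebesgue_cons.

(* Lebesgue measure on R^n, as the n-fold product of lebesgue_measure. *)
Fixpoint lebesgue_cV n : {sigma_finite_measure set 'cV[R]_n -> \bar R} :=
  match n with
  | 0 => \d_ (0 : 'cV[R]_0)
  | k.+1 => lebesgue_cons (lebesgue_cV k)
  end.

Lemma lebesgue_cV_box n (S : 'I_n -> set R) :
  (forall i, measurable (S i)) ->
  (lebesgue_cV n [set x : 'cV[R]_n | forall i, S i (x i ord0)] =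
   \prod_(i < n) (@lebesgue_measure R (S i)))%E.
Proof.
elim: n S => [|n IHn] S mS /=.
  by rewrite big_ord0 diracE mem_set// => -[].
rewrite big_ord_recl -IHn//.
have mU : measurable [set x : 'cV[R]_n | forall i : 'I_n,
    S (lift ord0 i) (x i ord0)].
  rewrite (_ : mkset _ = \bigcap_(i in [set: 'I_n])
    ((fun x : 'cV[R]_n => x i ord0 : R) @^-1` S (lift ord0 i))); last first.
    by apply/seteqP; split=> [x Sx i _|x Sx i]; [exact: Sx|exact: (Sx i I)].
  apply: fin_bigcap_measurable => // i _; rewrite -[X in measurable X]setTI.
  exact: measurable_coord_mx.
rewrite -(@product_measure1E _ _ _ _ _ (@lebesgue_measure R))//; last exact: mS.
rewrite /lebesgue_cons /pushforward; congr (product_measure1 _ _ _).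
apply/seteqP; split=> -[a v]; rewrite /cons_cV /=.
  move=> Sav; split=> [|i].
    have := Sav ord0; rewrite mxE; case: splitP => // k _.
    by rewrite !ord1 mxE mulr1n.
  have := Sav (lift ord0 i); rewrite mxE; case: splitP => [[[]]//|k /= /eqP].
  by rewrite /bump /= !add1n eqSS => /eqP/val_inj ->.
move=> [Sa Sv] i; rewrite mxE; case: splitP => [k ik|k ik].
  rewrite (_ : i = ord0) ?ord1 ?mxE//; apply: val_inj => /=.
  by rewrite ik ord1.
rewrite (_ : i = lift ord0 k); first exact: Sv.
by apply: val_inj => /=; rewrite ik.
Qed.

End borel_matrix.
Arguments lebesgue_cV {R n}.

Section probability_notions.
Context (R : realType).
Local Open Scope ereal_scope.

Definition minkowski_sum n (A B : set 'cV[R]_n) : set 'cV[R]_n :=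
  [set (a + b)%R | a in A & b in B].

Definition dilation n (zeta : R) (A : set 'cV[R]_n) : set 'cV[R]_n :=
  [set zeta *: a | a in A].

(* The combination of two convex Borel sets is convex but may fail to be Borel;
   mu_ext P is the outer measure of P, i.e. P itself on Borel sets and its
   completion on the sets that are measurable for the completion. *)
Definition log_concave n (P : probability 'cV[R]_n R) :=
  forall (A B : set 'cV[R]_n) (zeta : R),
    measurable A -> measurable B ->
    @convex_set R 'cV[R]_n A -> @convex_set R 'cV[R]_n B ->
    A !=set0 -> B !=set0 -> (0 <= zeta <= 1)%R ->
    (P A `^ zeta) * (P B `^ (1 - zeta)) <=
    mu_ext P (minkowski_sum (dilation zeta A) (dilation (1 - zeta) B)).

Definition has_density n (P : probability 'cV[R]_n R) :=
  exists f : 'cV[R]_n -> R, [/\ measurable_fun setT f,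
    forall z, (0 <= f z)%R &
    forall S, measurable S -> P S = \int[lebesgue_cV]_(z in S) (f z)%:E].

Definition mutually_independent d d' (T : measurableType d)
    (T' : measurableType d') (P : probability T R) (I : finType)
    (X : I -> {RV P >-> T'}) :=
  forall (J : {set I}) (S : I -> set T'),
    (forall i, i \in J -> measurable (S i)) ->
    P (\bigcap_(i in [set` J]) (X i @^-1` S i)) =
    \prod_(i in J) P (X i @^-1` S i).

Definition iid_with_law d d' (T : measurableType d) (T' : measurableType d')
    (P : probability T R) (I : finType) (X : I -> {RV P >-> T'})
    (Q : probability T' R) :=
  mutually_independent X /\
  forall i S, measurable S -> distribution P (X i) S = Q S.

End probability_notions.

Section dpv_system.
Context (R : realType).

(* Only the values x 0, ..., x N are constrained. *)
Definition dpv_trajectory N l n m p (Par : set 'cV[R]_l)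
    (A : Par -> 'M[R]_n) (B : Par -> 'M[R]_(n, m)) (F : Par -> 'M[R]_(n, p))
    (T : Type) (x0 : 'cV[R]_n) (lam : 'I_N -> Par) (u : 'I_N -> 'cV[R]_m)
    (w : 'I_N -> T -> 'cV[R]_p) (x : nat -> T -> 'cV[R]_n) :=
  (forall omega, x 0%N omega = x0) /\
  (forall (t : 'I_N) omega,
    x t.+1 omega = A (lam t) *m x t omega + B (lam t) *m u t
                   + F (lam t) *m w t omega).

Definition obstacle n (h : 'cV[R]_n -> R) (c : 'cV[R]_n) : set 'cV[R]_n :=
  [set z | 0 <= h (z - c)].

Definition occupancy n d (T : measurableType d) (P : probability T R)
    (h : 'cV[R]_n -> R) (x : nat -> T -> 'cV[R]_n) (y : 'cV[R]_n) (tau : nat) :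
    \bar R :=
  P (x tau @^-1` [set z | obstacle h z y]).

Definition PrOccupySet n d (T : measurableType d) (P : probability T R)
    (h : 'cV[R]_n -> R) (x : nat -> T -> 'cV[R]_n) (alpha : R) (tau : nat) :
    set 'cV[R]_n :=
  [set y | (alpha%:E <= occupancy P h x y tau)%E].

End dpv_system.

(* Main.v *)
(** Prekopa's argument, with the law of the disturbance as reference measure.
Call a probability Q on R^n Prekopa-Leindler if
(int f dQ)^z (int g dQ)^(1-z) <= int h dQ whenever f, g are log-concave and
h (z a + (1-z) b) >= f(a)^z g(b)^(1-z).
- A law that is log-concave on convex sets has this property: the superlevel
  measures s |-> Q{f >= s} satisfy Q{f >= s}^z Q{g >= t}^(1-z) <=
  Q{h >= s^z t^(1-z)}, and int f dQ = int_R e^(-u) Q{f >= e^(-u)} du, so the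
  one-dimensional Prekopa-Leindler inequality for Lebesgue measure applies.
- Dirac masses have it, and integrating out one variable at a time shows that
  affine images of products keep it; hence the law of every state x_t has it.
The occupancy at y is the mass that the law of x_tau gives to y - O(0). Applying
the inequality to the indicators of these sets yields convexity; continuity from
above along shrinking neighbourhoods of y - O(0), and along complements of
growing balls, yields closedness and boundedness. *)
Require Import Defs.
From HB Require Import structures.
From mathcomp Require Import all_boot all_order all_algebra.
From mathcomp Require Import all_classical all_reals all_analysis.
From mathcomp Require Import measurable_realfun.
From mathcomp Require Import ring lra.

Set Implicit Arguments.
Unset Strict Implicit.
Unset Printing Implicit Defensive.

Import Order.TTheory GRing.Theory Num.Theory.
Import numFieldNormedType.Exports.

Local Open Scope classical_set_scope.
Local Open Scope ring_scope.

(** * Brunn-Minkowski for bounded intervals of the line *)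

Section one_dim.
Context {R : realType}.
Local Notation mu := (@lebesgue_measure R).

Lemma lebesgue_le_sup_inf (I : set R) : measurable I -> has_sup I -> has_inf I ->
  (mu I <= (sup I - inf I)%:E)%E.
Proof.
move=> mI [I0 uI] [_ lI].
apply: (@le_trans _ _ (mu `[inf I, sup I]%classic)).
  apply: le_measure; rewrite ?inE//.
  by move=> x Ix /=; rewrite in_itv/= ge_inf// ub_le_sup.
rewrite lebesgue_measure_itv /= lte_fin; case: ifPn => // _.
case: I0 => i Ii; rewrite lee_fin subr_ge0.
exact: (le_trans (ge_inf lI Ii) (ub_le_sup uI Ii)).
Qed.

(** Join a combination of points near the two infima to a combination of points near the two
    suprema: this segment lies in [C], and its length is within [e] of the left side. [C] itself
    need not be an interval. *)
Lemma brunn_minkowski_itv (I J C : set R) (z : R) : 0 < z < 1 ->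
  is_interval I -> is_interval J -> has_sup I -> has_inf I ->
  has_sup J -> has_inf J -> measurable C ->
  (forall i j, I i -> J j -> C (z * i + (1 - z) * j)) ->
  (z%:E * mu I + (1 - z)%:E * mu J <= mu C)%E.
Proof.
move=> /andP[z0 z1] iI iJ sI lI sJ lJ mC hC.
have z1' : 0 < 1 - z by rewrite subr_gt0.
have seg i0 i1 j0 j1 : I i0 -> I i1 -> J j0 -> J j1 -> i0 <= i1 -> j0 <= j1 ->
    ((z * (i1 - i0) + (1 - z) * (j1 - j0))%:E <= mu C)%E.
  move=> Ii0 Ii1 Jj0 Jj1 i01 j01.
  set a := z * i0 + (1 - z) * j0; set b := z * i1 + (1 - z) * j1.
  have -> : z * (i1 - i0) + (1 - z) * (j1 - j0) = b - a by rewrite /a /b; ring.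
  have : a <= b by rewrite lerD// ler_wpM2l// ltW.
  rewrite le_eqVlt => /predU1P[->|ab]; first by rewrite subrr.
  have -> : (b - a)%:E = mu `[a, b]%classic.
    by rewrite lebesgue_measure_itv/= lte_fin ab.
  apply: le_measure; rewrite ?inE// => x /=; rewrite in_itv/= => /andP[ax xb].
  (* The relative position of [x] in [[a, b]] is used in both segments at once, which splits [x]
     into a combination of a point of [I] and a point of [J]. *)
  pose t := (x - a) / (b - a).
  have ba : 0 < b - a by rewrite subr_gt0.
  have t0 : 0 <= t by rewrite divr_ge0 ?subr_ge0// ltW.
  have t1 : t <= 1 by rewrite ler_pdivrMr// mul1r lerB.
  have xE : x = z * (i0 + t * (i1 - i0)) + (1 - z) * (j0 + t * (j1 - j0)).
    have : t * (b - a) = x - a by rewrite /t divfK// gt_eqF.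
    by rewrite /a /b => e; lra.
  by rewrite xE; apply: hC; [apply: (iI i0 i1)|apply: (iJ j0 j1)] => //; nra.
apply/lee_addgt0Pr => e e0.
have e20 : 0 < e / 2 by rewrite divr_gt0.
have [i1 Ii1 si1] := sup_adherent e20 sI.
have [i0 Ii0 li0] := inf_adherent e20 lI.
have [j1 Jj1 sj1] := sup_adherent e20 sJ.
have [j0 Jj0 lj0] := inf_adherent e20 lJ.
have mI := is_interval_measurable iI; have mJ := is_interval_measurable iJ.
apply: (@le_trans _ _ (z * (sup I - inf I) + (1 - z) * (sup J - inf J))%:E).
  rewrite [leRHS]EFinD !EFinM; apply: leeD; apply: lee_wpmul2l;
    rewrite ?lee_fin ?(ltW z0) ?(ltW z1')//; exact: lebesgue_le_sup_inf.
(* For large [e] the point near the supremum may lie left of the one near the infimum; the maximum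
   restores the order that [seg] asks for. *)
pose i1' := Num.max i0 i1; pose j1' := Num.max j0 j1.
have Ii1' : I i1' by rewrite /i1' maxEle; case: ifP.
have Jj1' : J j1' by rewrite /j1' maxEle; case: ifP.
have i01 : i0 <= i1' by rewrite le_max lexx.
have j01 : j0 <= j1' by rewrite le_max lexx.
have i11 : i1 <= i1' by rewrite le_max lexx orbT.
have j11 : j1 <= j1' by rewrite le_max lexx orbT.
apply: (le_trans _ (leeD (seg _ _ _ _ Ii0 Ii1' Jj0 Jj1' i01 j01) (lexx e%:E))).
rewrite -EFinD lee_fin.
have Hi : sup I - inf I <= i1' - i0 + e by lra.
have Hj : sup J - inf J <= j1' - j0 + e by lra.
have := ler_wpM2l (ltW z0) Hi; have := ler_wpM2l (ltW z1') Hj; lra.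
Qed.

End one_dim.

(** * Layer-cake formulas *)

Section layer_cake.
Context {R : realType}.
Local Notation mu := (@lebesgue_measure R).
Local Open Scope ereal_scope.

Lemma measurable_superlevel_prod d (T : measurableType d) (f : T -> \bar R)
    (k : measurableTypeR R -> R) :
  measurable_fun setT f -> measurable_fun setT k ->
  measurable [set xu : T * measurableTypeR R | (k xu.2)%:E <= f xu.1].
Proof.
move=> mf mk; rewrite -[X in measurable X]setTI; apply: measurable_lee => //.
  by apply/measurable_EFinP; apply: measurableT_comp.
exact: measurableT_comp.
Qed.

Lemma measurable_superlevel d (T : measurableType d) (f : T -> \bar R) (r : R) :
  measurable_fun setT f -> measurable [set x | r%:E <= f x].
Proof.
move=> mf; rewrite -[X in measurable X]setTI.
by apply: measurable_lee => //; exact: measurable_cst.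
Qed.

Lemma measurable_superlevel_measure d (T : measurableType d)
    (m : {sigma_finite_measure set T -> \bar R}) (f : T -> \bar R)
    (k : measurableTypeR R -> R) :
  measurable_fun setT f -> measurable_fun setT k ->
  measurable_fun setT (fun u => m [set x | (k u)%:E <= f x]).
Proof.
move=> mf mk.
have := measurable_fun_ysection m (measurable_superlevel_prod mf mk).
apply: eq_measurable_fun => u _ /=.
by congr (m _); apply/seteqP; split => x /=; rewrite /ysection/= inE.
Qed.

(** Tonelli on the region of pairs [(x, u)] with [k u <= f x]. The level [k] and the weight [w] stay
    free to serve two parametrisations: [k u = u] weighted by the indicator of []0, 1[], and
    [k u = w u = e^(-u)]. *)
Lemma integral_superlevel d (T : measurableType d)
    (m : {sigma_finite_measure set T -> \bar R}) (f : T -> \bar R)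
    (k w : measurableTypeR R -> R) :
  measurable_fun setT f -> measurable_fun setT k -> measurable_fun setT w ->
  (forall u, 0 <= w u)%R ->
  \int[m]_x \int[mu]_u ((w u)%:E * (\1_[set v | (k v)%:E <= f x]%E u)%:E) =
  \int[mu]_u ((w u)%:E * m [set x | (k u)%:E <= f x]).
Proof.
move=> mf mk mw w0.
pose E := [set xu : T * measurableTypeR R | (k xu.2)%:E <= f xu.1].
have mE : measurable E by exact: measurable_superlevel_prod.
pose h (xu : T * measurableTypeR R) := (w xu.2)%:E * (\1_E xu)%:E.
have mh : measurable_fun setT h.
  apply: emeasurable_funM; apply/measurable_EFinP; last exact: measurable_indic.
  exact: measurableT_comp.
have h0 xu : 0 <= h xu by rewrite mule_ge0// lee_fin.
transitivity (\int[m]_x \int[mu]_u h (x, u)).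
  by apply: eq_integral => x _; apply: eq_integral => u _.
rewrite (fubini_tonelli h mh h0); apply: eq_integral => u _.
have mEu : measurable [set x | (k u)%:E <= f x] by exact: measurable_superlevel.
rewrite -[in RHS](setIT [set x | _]) -integral_indic//.
rewrite -ge0_integralZl// ?lee_fin//.
- by apply/measurable_EFinP/measurable_indic.
Qed.

(** The length of []0, c]] after the substitution [s = e^(-u)]: for [c > 0] the indicator cuts the
    integral down to [[- ln c, +oo[]. *)
Lemma integral_expRN_superlevel (c : R) : (0 <= c)%R ->
  \int[mu]_u ((expR (- u))%:E * (\1_[set v | (expR (- v) <= c)%R] u)%:E) = c%:E.
Proof.
rewrite le_eqVlt => /predU1P[<-|c0].
  apply: integral0_eq => u _; rewrite indicE memNset ?mule0//=.
  by apply/negP; rewrite -ltNge expR_gt0.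
transitivity (\int[mu]_(u in `[(- ln c)%R, +oo[%classic) (expR (- u))%:E).
  rewrite [RHS]integral_mkcond; apply: eq_integral => u _.
  rewrite indicE patchE.
  have -> : (u \in [set v | (expR (- v) <= c)%R]) = (u \in `[(- ln c)%R, +oo[%classic).
    have cE : (expR (- u) <= c)%R = (- ln c <= u)%R.
      by rewrite -{1}[c]lnK ?posrE// ler_expR lerNl.
    by apply/idP/idP; rewrite !inE/= in_itv/= andbT cE.
  by case: ifPn => _; rewrite ?mule1 ?mule0.
have cE : continuous (fun z : R => expR (- z)).
  move=> z; apply: continuous_comp; last exact: continuous_expR.
  exact: (@continuousN _ R^o).
(* The primitive [- e^(-x)] tends to [0] at infinity and equals [- c] at [- ln c]. *)
rewrite (@ge0_continuous_FTC2y _ _ (fun x => - expR (- x))%R _ 0%R).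
- by rewrite opprK lnK ?posrE// EFinN oppeK add0e.
- by move=> x _; exact: expR_ge0.
- exact: continuous_subspaceT.
- by rewrite -oppr0; apply: cvgN; exact: cvgr_expR.
- by move=> x _; exact: ex_derive.
- by apply: cvgN; apply/cvg_at_right_filter; exact: cE.
- move=> z _.
  rewrite derive1N// derive1_comp// derive1N// derive1_id mulrN1.
  rewrite derive1E; have /funeqP -> := @derive_expR R.
  by rewrite opprK.
Qed.

Lemma lebesgue_superlevel01 (c : R) : (0 <= c <= 1)%R ->
  \int[mu]_u ((\1_`]0%R, 1%R[ u)%:E * (\1_[set v | (v <= c)%R] u)%:E) = c%:E.
Proof.
move=> /andP[c0 c1].
transitivity (\int[mu]_u (\1_(`]0%R, 1%R[%classic `&` [set v | (v <= c)%R]) u)%:E).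
  by apply: eq_integral => u _; rewrite indicI.
have -> : [set v | (v <= c)%R] = `]-oo, c]%classic.
  by apply/seteqP; split => x /=; rewrite in_itv.
rewrite integral_indic// ?setIT; last exact: measurableI.
apply/eqP; rewrite eq_le; apply/andP; split.
  apply: (@le_trans _ _ (mu `[0%R, c]%classic)).
    apply: le_measure; rewrite ?inE//; first exact: measurableI.
    by move=> x /=; rewrite !in_itv/= => -[/andP[/ltW -> _] ->].
  rewrite lebesgue_measure_itv/= lte_fin; case: ifPn => _; last by rewrite lee_fin.
  by rewrite sube0.
have [->|cN0] := eqVneq c 0%R; first exact: measure_ge0.
apply: (@le_trans _ _ (mu `]0%R, c[%classic)).
  by rewrite lebesgue_measure_itv/= lte_fin lt0r cN0 c0 sube0.
apply: le_measure; rewrite ?inE//; first exact: measurableI.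
move=> x /=; rewrite !in_itv/= => /andP[-> xc]; split; last exact: ltW.
exact: lt_le_trans c1.
Qed.

End layer_cake.

(** * The Prekopa-Leindler inequality on the line *)

Section prekopa_leindler_line.
Context {R : realType}.
Local Notation mu := (@lebesgue_measure R).

(** Young's inequality for [a^z] and [b^(1-z)] with the conjugate exponents [1/z] and [1/(1-z)]. *)
Lemma geometric_le_arithmetic (a b z : R) : 0 <= a -> 0 <= b -> 0 < z < 1 ->
  a `^ z * b `^ (1 - z) <= z * a + (1 - z) * b.
Proof.
move=> a0 b0 /andP[z0 z1]; have z1' : 0 < 1 - z by rewrite subr_gt0.
have e : z + (1 - z) = 1 by ring.
have := @conjugate_powR R (a `^ z) (b `^ (1 - z)) z^-1 (1 - z)^-1.
rewrite -!powRrM !divff ?gt_eqF// !powRr1// !invrK => /(_ (powR_ge0 _ _) (powR_ge0 _ _)).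
rewrite e !invr_gt0 => /(_ z0 z1' erefl).
by rewrite [a * z]mulrC [b * _]mulrC.
Qed.

Lemma min_le_geometric (a b z : R) : 0 <= a -> 0 <= b -> 0 < z < 1 ->
  Num.min a b <= a `^ z * b `^ (1 - z).
Proof.
move=> a0 b0 /andP[z0 z1]; have z1' : 0 < 1 - z by rewrite subr_gt0.
have m0 : 0 <= Num.min a b by rewrite le_min a0 b0.
apply: (@le_trans _ _ (Num.min a b `^ z * Num.min a b `^ (1 - z))).
  have [->|mN0] := eqVneq (Num.min a b) 0; first by rewrite mulr_ge0 ?powR_ge0.
  have e : z + (1 - z) = 1 by ring.
  by rewrite -powRD ?mN0 ?implybT// e powRr1.
apply: ler_pM; rewrite ?powR_ge0//; apply: ge0_ler_powR;
  by rewrite ?nnegrE ?(ltW z0) ?(ltW z1')// ge_min lexx ?orbT.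
Qed.

(** Quasi-concavity together with decay at infinity. Levels are positive because at level [0] a
    nonnegative function has the whole line as superlevel set. *)
Definition bounded_interval_superlevels (F : R -> R) := forall r, 0 < r ->
  [/\ is_interval [set u | r <= F u], has_ubound [set u | r <= F u] &
      has_lbound [set u | r <= F u]].

Lemma integral_superlevel01 (F : measurableTypeR R -> R) :
  measurable_fun setT F -> (forall u, 0 <= F u <= 1) ->
  (\int[mu]_u (F u)%:E =
   \int[mu]_u ((\1_`]0%R, 1%R[ u)%:E * mu [set x | (u <= F x)%R]))%E.
Proof.
move=> mF F01.
rewrite -(@integral_superlevel _ _ _ mu (EFin \o F) id (\1_`]0%R, 1%R[))//.
- by apply: eq_integral => u _; rewrite -(lebesgue_superlevel01 (F01 u)).
- exact/measurable_EFinP.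
Qed.

(** At each level in []0, 1[] the superlevel sets of [F] and [G] are nonempty bounded intervals
    whose combinations lie in that of [H]. Brunn-Minkowski, applied level by level and integrated,
    gives the sum. *)
Lemma prekopa_leindler_line_normalized (F G H : measurableTypeR R -> R) (z : R) :
  0 < z < 1 ->
  measurable_fun setT F -> measurable_fun setT G -> measurable_fun setT H ->
  (forall u, 0 <= F u <= 1) -> (forall u, 0 <= G u <= 1) ->
  (forall u, 0 <= H u) ->
  bounded_interval_superlevels F -> bounded_interval_superlevels G ->
  (forall r, r < 1 -> exists u, r <= F u) ->
  (forall r, r < 1 -> exists u, r <= G u) ->
  (forall u v, Num.min (F u) (G v) <= H (z * u + (1 - z) * v)) ->
  (z%:E * \int[mu]_u (F u)%:E + (1 - z)%:E * \int[mu]_u (G u)%:E <=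
   \int[mu]_u (H u)%:E)%E.
Proof.
move=> z01 mF mG mH F01 G01 H0 bF bG sF sG FGH.
have /andP[z0 z1] := z01; have z1' : 0 < 1 - z by rewrite subr_gt0.
(* Truncating at 1 is harmless since F, G <= 1, and makes the layer cake over
   the levels in ]0, 1[ exact. *)
pose H1 u := Num.min (H u) 1.
have mH1 : measurable_fun setT H1.
  by apply: measurable_minr => //; exact: measurable_cst.
have H101 u : 0 <= H1 u <= 1 by rewrite le_min H0 ler01 ge_min lexx orbT.
apply: (@le_trans _ _ (\int[mu]_u (H1 u)%:E)%E); last first.
  apply: ge0_le_integral => //.
  - by move=> u _; rewrite lee_fin; case/andP: (H101 u).
  - exact/measurable_EFinP.
  - exact/measurable_EFinP.
  - by move=> u _; rewrite lee_fin ge_min lexx.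
rewrite !integral_superlevel01//.
have ze0 : (0 <= z%:E)%E by rewrite lee_fin ltW.
have ze1 : (0 <= (1 - z)%:E)%E by rewrite lee_fin ltW.
have ind0 (u : R) :
    (0 <= (\1_(`]0%R, 1%R[%classic : set R) u)%:E :> \bar R)%E.
  by rewrite lee_fin.
have mI f : measurable_fun setT f ->
    measurable_fun setT (fun u : measurableTypeR R =>
      (\1_`]0%R, 1%R[ u)%:E * mu [set x | (u <= f x)%R])%E.
  move=> mf; apply: emeasurable_funM; last first.
    apply: (@measurable_superlevel_measure _ _ _ mu (EFin \o f) id) => //.
    exact/measurable_EFinP.
  by apply/measurable_EFinP; exact: measurable_indic.
have I0 f u : (0 <= (\1_`]0%R, 1%R[ u)%:E * mu [set x | (u <= f x)%R])%E.
  exact: mule_ge0.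
have mZ (c : R) f : measurable_fun setT f ->
    measurable_fun setT (fun u : measurableTypeR R =>
      c%:E * ((\1_`]0%R, 1%R[ u)%:E * mu [set x | (u <= f x)%R]))%E.
  by move=> mf; apply: emeasurable_funM; [exact: measurable_cst|exact: mI].
rewrite -!ge0_integralZl//; [|exact: mI|exact: mI].
rewrite -ge0_integralD//; last 4 first.
- by move=> u _; rewrite mule_ge0.
- exact: mZ.
- by move=> u _; rewrite mule_ge0.
- exact: mZ.
apply: ge0_le_integral => //.
- by move=> u _; rewrite adde_ge0// mule_ge0.
- by apply: emeasurable_funD; exact: mZ.
- exact: mI.
move=> r _; rewrite indicE; case: (boolP (r \in _)) => [|_]; last first.
  by rewrite !mul0e !mule0 adde0.
rewrite inE/= in_itv/= => /andP[r0 r1]; rewrite !mul1e.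
have [iF uF lF] := bF _ r0; have [iG uG lG] := bG _ r0.
apply: brunn_minkowski_itv => //.
- by split=> //; exact: sF.
- by split=> //; exact: sF.
- by split=> //; exact: sG.
- by split=> //; exact: sG.
- apply: (@measurable_superlevel _ _ _ (EFin \o H1)).
  exact/measurable_EFinP.
- move=> i j /= ri rj; rewrite le_min (ltW r1) andbT.
  by apply: le_trans (FGH i j); rewrite le_min ri rj.
Qed.

(** The normalised inequality for [F / MF], [G / MG] and [H / c], followed by the
    arithmetic-geometric mean inequality; [c] is exactly what the suprema contribute to the
    geometric mean. *)
Lemma prekopa_leindler_line (F G H : measurableTypeR R -> R) (z : R) :
  0 < z < 1 ->
  measurable_fun setT F -> measurable_fun setT G -> measurable_fun setT H ->
  (forall u, 0 <= F u <= 1) -> (forall u, 0 <= G u <= 1) ->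
  (forall u, 0 <= H u) ->
  bounded_interval_superlevels F -> bounded_interval_superlevels G ->
  (\int[mu]_u (F u)%:E < +oo)%E -> (\int[mu]_u (G u)%:E < +oo)%E ->
  (forall u v, F u `^ z * G v `^ (1 - z) <= H (z * u + (1 - z) * v)) ->
  ((\int[mu]_u (F u)%:E) `^ z * (\int[mu]_u (G u)%:E) `^ (1 - z) <=
   \int[mu]_u (H u)%:E)%E.
Proof.
move=> z01 mF mG mH F01 G01 H0 bF bG iF iG FGH.
have /andP[z0 z1] := z01; have z1' : 0 < 1 - z by rewrite subr_gt0.
have supP (K : measurableTypeR R -> R) : (forall u, 0 <= K u <= 1) ->
    [/\ 0 <= sup (range K), forall u, K u <= sup (range K) &
        forall r, r < sup (range K) -> exists u, r <= K u].
  move=> K01.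
  have sK : has_sup (range K).
    by split; [exists (K 0), 0|exists 1 => _ [u _ <-]; case/andP: (K01 u)].
  have uK u : K u <= sup (range K) by apply: (ub_le_sup sK.2); exists u.
  split=> //; first by apply: le_trans (uK 0); case/andP: (K01 0).
  move=> r rs; have rs' : 0 < sup (range K) - r by rewrite subr_gt0.
  have [_ [u _ <-]] := sup_adherent rs' sK.
  by rewrite subKr => /ltW; exists u.
have intH0 : (0 <= \int[mu]_u (H u)%:E)%E by apply: integral_ge0 => u _; rewrite lee_fin.
have zero (K : measurableTypeR R -> R) : (forall u, 0 <= K u <= 1) ->
    sup (range K) = 0 -> (\int[mu]_u (K u)%:E = 0)%E.
  move=> K01 K0; apply: integral0_eq => u _; have [_ /(_ u) + _] := supP K K01.
  by rewrite K0 => Ku; congr EFin; apply/eqP; rewrite eq_le Ku; case/andP: (K01 u).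
have [MF0 FM FE] := supP F F01; have [MG0 GM GE] := supP G G01.
set MF := sup (range F) in MF0 FM FE; set MG := sup (range G) in MG0 GM GE.
(* A function with supremum [0] has integral [0], and a positive power of it annihilates the left
   side. *)
have [MFE|MFN] := eqVneq MF 0.
  by rewrite zero// poweR0r ?mul0e// gt_eqF.
have [MGE|MGN] := eqVneq MG 0.
  by rewrite [X in (_ * X `^ _)%E]zero// poweR0r ?mule0// gt_eqF.
have MFp : 0 < MF by rewrite lt0r MFN.
have MGp : 0 < MG by rewrite lt0r MGN.
(* Rescaling F and G to supremum 1 makes their superlevel sets nonempty at the
   same levels, so that the arithmetic-mean inequality can be used. *)
pose c := MF `^ z * MG `^ (1 - z).
have c0 : 0 < c by rewrite mulr_gt0// powR_gt0.
have scale_sup (K : measurableTypeR R -> R) M : 0 < M ->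
    bounded_interval_superlevels K ->
    bounded_interval_superlevels (fun u => M^-1 * K u).
  move=> M0 bK r r0; have -> : [set u | r <= M^-1 * K u] = [set u | M * r <= K u].
    by apply/seteqP; split => u /=; rewrite ler_pdivlMl.
  by apply: bK; rewrite mulr_gt0.
have le1 (K : measurableTypeR R -> R) M : 0 < M -> (forall u, 0 <= K u <= 1) ->
    (forall u, K u <= M) -> forall u, 0 <= M^-1 * K u <= 1.
  move=> M0 K01 KM u; have /andP[K0 _] := K01 u.
  by rewrite mulr_ge0 ?invr_ge0 ?(ltW M0)//= ler_pdivrMl// mulr1.
have att (K : measurableTypeR R -> R) M : 0 < M ->
    (forall r, r < M -> exists u, r <= K u) ->
    (forall r, r < 1 -> exists u, r <= M^-1 * K u).
  move=> M0 KM r r1; have [|u ru] := KM (M * r); first by rewrite gtr_pMr.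
  by exists u; rewrite ler_pdivlMl.
have := @prekopa_leindler_line_normalized (fun u => MF^-1 * F u)
  (fun u => MG^-1 * G u) (fun u => c^-1 * H u) z z01.
have mS (K : measurableTypeR R -> R) M : measurable_fun setT K ->
    measurable_fun setT (fun u => M * K u).
  by move=> mK; apply: measurable_funM => //; exact: measurable_cst.
move=> /(_ (mS _ _ mF) (mS _ _ mG) (mS _ _ mH) (le1 _ _ MFp F01 FM)).
move=> /(_ (le1 _ _ MGp G01 GM)).
have Hc0 u : 0 <= c^-1 * H u by rewrite mulr_ge0 ?invr_ge0 ?(ltW c0).
move=> /(_ Hc0 (scale_sup _ _ MFp bF) (scale_sup _ _ MGp bG)).
move=> /(_ (att _ _ MFp FE) (att _ _ MGp GE)).
have hyp u v : Num.min (MF^-1 * F u) (MG^-1 * G v) <=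
    c^-1 * H (z * u + (1 - z) * v).
  have /andP[Fu0 _] := F01 u; have /andP[Gv0 _] := G01 v.
  apply: (@le_trans _ _ ((MF^-1 * F u) `^ z * (MG^-1 * G v) `^ (1 - z))).
    by apply: min_le_geometric => //; rewrite mulr_ge0 ?invr_ge0.
  rewrite !powRM ?invr_ge0// mulrACA.
  have -> : MF^-1 `^ z * MG^-1 `^ (1 - z) = c^-1.
    by rewrite /c invfM -[MF^-1]powR_inv1// -[MG^-1]powR_inv1// -!powRrM !mulN1r !powRN.
  by rewrite ler_pM2l ?invr_gt0.
move=> /(_ hyp).
have intZ (K : measurableTypeR R -> R) M : 0 < M -> measurable_fun setT K ->
    (forall u, 0 <= K u) ->
    (\int[mu]_u (M^-1 * K u)%:E = M^-1%:E * \int[mu]_u (K u)%:E)%E.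
  move=> M0 mK K0; under eq_integral do rewrite EFinM.
  rewrite ge0_integralZl//.
  - exact/measurable_EFinP.
  - by move=> u _; rewrite lee_fin.
  - by rewrite lee_fin invr_ge0 ltW.
have F0 u : 0 <= F u by case/andP: (F01 u).
have G0 u : 0 <= G u by case/andP: (G01 u).
rewrite !intZ//.
(* Once the integral of [H] is finite, all three integrals are real numbers and the rest is real
   arithmetic. *)
have [->|Hfin] := eqVneq (\int[mu]_u (H u)%:E)%E +oo%E; first by rewrite leey.
have fnum (K : measurableTypeR R -> R) : (forall u, 0 <= K u) ->
    (\int[mu]_u (K u)%:E < +oo)%E -> (\int[mu]_u (K u)%:E)%E \is a fin_num.
  by move=> K0 ?; rewrite ge0_fin_numE// integral_ge0// => u _; rewrite lee_fin.
have fnge0 (K : measurableTypeR R -> R) : (forall u, 0 <= K u) ->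
    0 <= fine (\int[mu]_u (K u)%:E).
  by move=> K0; rewrite fine_ge0// integral_ge0// => u _; rewrite lee_fin.
have XE := fineK (fnum F F0 iF); have YE := fineK (fnum G G0 iG).
have WE := fineK (fnum H H0 ltac:(by rewrite ltey)).
have X0 := fnge0 F F0; have Y0 := fnge0 G G0.
rewrite -XE -YE -WE -!EFinM -EFinD !lee_fin.
set X := fine (\int[mu]_u (F u)%:E) in X0 *.
set Y := fine (\int[mu]_u (G u)%:E) in Y0 *.
set W := fine (\int[mu]_u (H u)%:E) => XYW.
have -> : X `^ z * Y `^ (1 - z) =
    c * ((MF^-1 * X) `^ z * (MG^-1 * Y) `^ (1 - z)).
  rewrite /c mulrACA -!powRM ?mulr_ge0 ?invr_ge0//.
  by rewrite !mulrA !divff// !mul1r.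
rewrite -ler_pdivlMl//; apply: le_trans XYW.
by apply: geometric_le_arithmetic; rewrite ?mulr_ge0 ?invr_ge0.
Qed.

End prekopa_leindler_line.

(** * From log-concave laws to the Prekopa-Leindler property *)

Section log_concave_functions.
Context {R : realType}.
Local Notation mu := (@lebesgue_measure R).
Local Open Scope ereal_scope.

Definition log_concave_fun n (f : 'cV[R]_n -> \bar R) :=
  forall (z : R) x y, (0 < z < 1)%R ->
    f x `^ z * f y `^ (1 - z) <= f (z *: x + (1 - z) *: y)%R.

(** The bound [1] keeps integrals against a probability finite; the class contains the indicators of
    Borel sets and is stable under integrating out a variable. *)
Definition unit_measurable n (f : 'cV[R]_n -> \bar R) :=
  measurable_fun setT f /\ forall x, 0 <= f x <= 1.

(** [f] and [g] range over log-concave functions because a log-concave law is controlled on convex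
    sets only, here their superlevel sets. *)
Definition prekopa_leindler n (Q : probability 'cV[R]_n R) :=
  forall (z : R) (f g h : 'cV[R]_n -> \bar R), (0 < z < 1)%R ->
    unit_measurable f -> unit_measurable g -> unit_measurable h ->
    log_concave_fun f -> log_concave_fun g ->
    (forall x y, f x `^ z * g y `^ (1 - z) <= h (z *: x + (1 - z) *: y)%R) ->
    (\int[Q]_x f x) `^ z * (\int[Q]_x g x) `^ (1 - z) <= \int[Q]_x h x.

Lemma lee_geometric (a b c e : \bar R) (z : R) : (0 < z < 1)%R ->
  0 <= a -> 0 <= b -> a <= c -> b <= e ->
  a `^ z * b `^ (1 - z) <= c `^ z * e `^ (1 - z).
Proof.
move=> /andP[z0 z1] a0 b0 ac be.
have z1' : (0 <= 1 - z)%R by rewrite subr_ge0 ltW.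
have c0 := le_trans a0 ac; have e0 := le_trans b0 be.
by apply: lee_pmul; rewrite ?poweR_ge0//; apply: gt0_ler_poweR;
  rewrite ?in_itv/= ?leey ?a0 ?b0 ?c0 ?e0// ltW.
Qed.

Lemma geometric_id (a : \bar R) (z : R) : (0 < z < 1)%R -> 0 <= a ->
  a `^ z * a `^ (1 - z) = a.
Proof.
move=> /andP[z0 z1] a0; rewrite -poweRD; last first.
  by apply: add_neq0_poweRD_def; rewrite addrC subrK.
by rewrite addrC subrK poweRe1.
Qed.

Lemma convex_superlevel n (f : 'cV[R]_n -> \bar R) (s : R) : (0 <= s)%R ->
  log_concave_fun f -> @convex_set R 'cV[R]_n [set x | s%:E <= f x].
Proof.
move=> s0 lf; apply/convex_setW => x y; rewrite !inE/= => sx sy k k0 k1.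
have k01 : (0 < k%:num < 1)%R by rewrite k0 k1.
rewrite inE/=; change (s%:E <= f (k%:num *: x + (1 - k%:num) *: y)%R).
apply: (le_trans _ (lf k%:num x y k01)).
rewrite -[leLHS](geometric_id k01) ?lee_fin//.
by apply: lee_geometric; rewrite ?lee_fin.
Qed.

Section of_log_concave.
Context n (Q : probability 'cV[R]_n R).
Hypothesis lcQ : log_concave Q.

Lemma superlevel_log_concave (f g h : 'cV[R]_n -> \bar R) (z s t : R) :
  (0 < z < 1)%R -> unit_measurable f -> unit_measurable g ->
  unit_measurable h -> log_concave_fun f -> log_concave_fun g ->
  (forall x y, f x `^ z * g y `^ (1 - z) <= h (z *: x + (1 - z) *: y)%R) ->
  (0 <= s)%R -> (0 <= t)%R ->
  Q [set x | s%:E <= f x] `^ z * Q [set x | t%:E <= g x] `^ (1 - z) <=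
  Q [set x | (s `^ z * t `^ (1 - z))%:E <= h x].
Proof.
move=> z01 [mf _] [mg _] [mh _] lf lg fgh s0 t0.
have /andP[z0 z1] := z01; have z1' : (0 < 1 - z)%R by rewrite subr_gt0.
(* [log_concave] speaks of nonempty sets; an empty superlevel set makes the left side [0]. *)
have [->|/set0P f0] := eqVneq [set x | s%:E <= f x] set0.
  by rewrite measure0 poweR0r ?mul0e// gt_eqF.
have [->|/set0P g0] := eqVneq [set x | t%:E <= g x] set0.
  by rewrite measure0 [X in _ * X]poweR0r ?mule0// gt_eqF.
apply: (le_trans (@lcQ _ _ z _ _ _ _ f0 g0 _)).
- exact: measurable_superlevel.
- exact: measurable_superlevel.
- exact: convex_superlevel.
- exact: convex_superlevel.
- by rewrite !ltW.
(* The Minkowski combination may fail to be Borel, but the superlevel set of [h] that contains it is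
   Borel, so there the outer measure is [Q]. *)
rewrite -(measurable_mu_extE Q); last exact: measurable_superlevel.
apply: le_mu_ext => _ [_ [x /= sx <-] [_ [y /= ty <-] <-]] /=.
apply: (le_trans _ (fgh x y)); rewrite EFinM -!poweR_EFin.
by apply: lee_geometric; rewrite ?lee_fin.
Qed.

(** The layer-cake integrand in the variable [u = - ln s], which turns geometric means of levels
    into convex combinations. [fine] loses nothing for measurable [f], since [Q] is finite. *)
Let phi (f : 'cV[R]_n -> \bar R) (u : measurableTypeR R) : R :=
  (expR (- u) * fine (Q [set x | (expR (- u))%:E <= f x]%E))%R.

Let phiE f u : unit_measurable f ->
  (phi f u)%:E = (expR (- u))%:E * Q [set x | (expR (- u))%:E <= f x].
Proof.
move=> [mf _]; rewrite EFinM fineK// fin_num_measure//.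
exact: measurable_superlevel.
Qed.

Let mexpRN : measurable_fun setT (fun u : measurableTypeR R => expR (- u)).
Proof. by apply: measurableT_comp => //; exact: measurable_expR. Qed.

Let measurable_phi f : unit_measurable f -> measurable_fun setT (phi f).
Proof.
move=> uf; apply/measurable_EFinP.
rewrite (_ : _ \o _ = fun u : measurableTypeR R =>
  (expR (- u))%:E * Q [set x | (expR (- u))%:E <= f x]); last first.
  by apply/funext => u /=; rewrite phiE.
apply: emeasurable_funM; first exact/measurable_EFinP.
by apply: measurable_superlevel_measure => //; case: uf.
Qed.

Let integral_phi f : unit_measurable f ->
  \int[Q]_x f x = \int[mu]_u (phi f u)%:E.
Proof.
move=> uf; under [RHS]eq_integral do rewrite phiE//.
have [mf f01] := uf.
rewrite -(@integral_superlevel _ _ _ Q f _ _ mf mexpRN mexpRN); last first.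
  by move=> u; exact: expR_ge0.
apply: eq_integral => x _; have /andP[fx0 fx1] := f01 x.
have fE : f x = (fine (f x))%:E.
  by rewrite fineK// ge0_fin_numE// (le_lt_trans fx1)// ltry.
rewrite fE -[LHS](integral_expRN_superlevel (fine_ge0 fx0)).
by apply: eq_integral => u _.
Qed.

Let phi_lt0 f u : unit_measurable f -> (u < 0)%R -> phi f u = 0%R.
Proof.
move=> [_ f01] u0; rewrite /phi (_ : mkset _ = set0) ?measure0 ?mulr0//.
apply/seteqP; split => // x /= ux; have /andP[_ fx1] := f01 x.
have := le_trans ux fx1; rewrite lee_fin leNgt -expR0 ltr_expR.
by rewrite ltrNr oppr0 u0.
Qed.

Let phi_le_expR f u : unit_measurable f -> (0 <= phi f u <= expR (- u))%R.
Proof.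
move=> [mf _]; rewrite /phi mulr_ge0 ?expR_ge0 ?fine_ge0//=.
rewrite ger_pMr ?expR_gt0// -lee_fin fineK; last first.
  by rewrite fin_num_measure//; exact: measurable_superlevel.
by apply: probability_le1; exact: measurable_superlevel.
Qed.

Let phi01 f u : unit_measurable f -> (0 <= phi f u <= 1)%R.
Proof.
move=> uf; have /andP[p0 pe] := phi_le_expR u uf; rewrite p0/=.
have [u0|u0] := ltP u 0%R; first by rewrite phi_lt0.
by apply: (le_trans pe); rewrite -expR0 ler_expR lerNl oppr0.
Qed.

Let phi_log_concave f g h z u v : (0 < z < 1)%R ->
  unit_measurable f -> unit_measurable g -> unit_measurable h ->
  log_concave_fun f -> log_concave_fun g ->
  (forall x y, f x `^ z * g y `^ (1 - z) <= h (z *: x + (1 - z) *: y)%R) ->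
  (phi f u `^ z * phi g v `^ (1 - z) <= phi h (z * u + (1 - z) * v))%R.
Proof.
move=> z01 uf ug uh lf lg fgh.
have expE : (expR (- u) `^ z * expR (- v) `^ (1 - z) =
    expR (- (z * u + (1 - z) * v)))%R.
  rewrite /powR !gt_eqF ?expR_gt0// !expRK -expRD; congr expR; ring.
rewrite -lee_fin phiE// -expE EFinM -!poweR_EFin !phiE//.
rewrite !poweRM// ?lee_fin ?expR_ge0// muleACA.
rewrite EFinM; apply: lee_wpmul2l; first by rewrite mule_ge0// poweR_ge0.
by apply: superlevel_log_concave; rewrite ?expR_ge0.
Qed.

(** Intervals come from [phi_log_concave] with three equal functions. The bound [e^(-u)] confines
    the set on the right, and the vanishing of [phi] at negative [u] confines it on the left. *)
Let phi_superlevels f : unit_measurable f -> log_concave_fun f ->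
  bounded_interval_superlevels (phi f).
Proof.
move=> uf lf r r0; split.
- move=> x y /= rx ry w /andP[].
  rewrite le_eqVlt => /predU1P[<-//|xw]; rewrite le_eqVlt => /predU1P[->//|wy].
  have yx : (0 < y - x)%R by rewrite subr_gt0 (lt_trans xw).
  pose t := ((y - w) / (y - x))%R.
  have t01 : (0 < t < 1)%R.
    apply/andP; split; first by rewrite divr_gt0// subr_gt0.
    by rewrite ltr_pdivrMr// mul1r ltrD2l ltrN2.
  have -> : w = (t * x + (1 - t) * y)%R.
    have e : (t * (y - x) = y - w)%R by rewrite /t divfK// gt_eqF.
    by lra.
  apply: le_trans (phi_log_concave x y t01 uf uf uf lf lf (fun _ _ => lf _ _ _ t01)).
  apply: le_trans (min_le_geometric _ _ t01).
  + by rewrite le_min rx ry.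
  + by case/andP: (phi01 x uf).
  + by case/andP: (phi01 y uf).
- exists (- ln r)%R => u /= ru; rewrite lerNr -ler_expR lnK ?posrE//.
  by apply: le_trans ru _; case/andP: (phi_le_expR u uf).
- exists 0%R => u /= ru; rewrite leNgt; apply/negP => u0.
  by move: ru; rewrite phi_lt0// leNgt r0.
Qed.

Lemma log_concave_prekopa_leindler : prekopa_leindler Q.
Proof.
move=> z f g h z01 uf ug uh lf lg fgh.
have fin k : unit_measurable k -> \int[mu]_u (phi k u)%:E < +oo.
  move=> uk; rewrite -integral_phi//; apply: (@le_lt_trans _ _ 1); last exact: ltry.
  apply: (@le_trans _ _ (\int[Q]_x 1)); last first.
    by rewrite integral_cst//= mul1e probability_setT.
  apply: ge0_le_integral => //; first by move=> x _; case/andP: (uk.2 x).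
    by case: uk.
  by move=> x _; case/andP: (uk.2 x).
rewrite !integral_phi//; apply: prekopa_leindler_line => //.
- exact: measurable_phi.
- exact: measurable_phi.
- exact: measurable_phi.
- by move=> u; exact: phi01.
- by move=> u; exact: phi01.
- by move=> u; case/andP: (phi01 u uh).
- exact: phi_superlevels.
- exact: phi_superlevels.
- exact: fin.
- exact: fin.
- by move=> u v; exact: phi_log_concave.
Qed.

End of_log_concave.
End log_concave_functions.

(** * Stability of the Prekopa-Leindler property *)

Section prekopa_leindler_transfer.
Context {R : realType}.
Local Open Scope ereal_scope.

Lemma prekopa_leindler_dirac n (x0 : 'cV[R]_n) : prekopa_leindler (\d_ x0).
Proof.
move=> z f g h _ [mf _] [mg _] [mh _] _ _ fgh.
rewrite !integral_dirac// !diracT !mul1e; apply: (le_trans (fgh x0 x0)).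
by rewrite -scalerDl addrC subrK scale1r.
Qed.

Section affine_image.
Context (n p q : nat) (Q : probability 'cV[R]_n R) (W : probability 'cV[R]_p R).
Variable Phi : {mfun ('cV[R]_n * 'cV[R]_p)%type >-> 'cV[R]_q}.
Hypothesis Phi_affine : forall (z : R) x y a b,
  Phi (z *: x + (1 - z) *: y, z *: a + (1 - z) *: b)%R =
  (z *: Phi (x, a) + (1 - z) *: Phi (y, b))%R.

Let unit_section f x : unit_measurable f -> unit_measurable (fun a => f (Phi (x, a))).
Proof.
move=> [mf f01]; split => //; apply: (measurableT_comp mf).
exact: (measurableT_comp (measurable_funPT Phi)).
Qed.

Let log_concave_section f x :
  log_concave_fun f -> log_concave_fun (fun a => f (Phi (x, a))).
Proof.
move=> lf z a b z01; apply: (le_trans (lf z _ _ z01)).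
by rewrite -Phi_affine -scalerDl [(z + _)%R]addrC subrK scale1r.
Qed.

Let partial f x := \int[W]_a f (Phi (x, a)).

Let partial_unit f : unit_measurable f -> unit_measurable (partial f).
Proof.
move=> uf; split.
  apply: (measurable_fun_fubini_tonelli_F (fun xa => f (Phi xa))) => /=.
    by apply: measurableT_comp => //; case: uf.
  by move=> xa; case/andP: (uf.2 (Phi xa)).
move=> x; have [mfx fx01] := unit_section x uf; apply/andP; split.
  by apply: integral_ge0 => a _; case/andP: (fx01 a).
apply: (@le_trans _ _ (\int[W]_a 1)).
  apply: ge0_le_integral => // a _; first by case/andP: (fx01 a).
  by case/andP: (fx01 a).
by rewrite integral_cst//= mul1e probability_setT.
Qed.

Hypothesis plW : prekopa_leindler W.

(** As [Phi] is jointly affine, the sections of [f] at [x], of [g] at [y] and of [h] at the combined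
    point satisfy the hypothesis of [plW]. *)
Let partial_prekopa_leindler f g h z x y : (0 < z < 1)%R ->
  unit_measurable f -> unit_measurable g -> unit_measurable h ->
  log_concave_fun f -> log_concave_fun g ->
  (forall x y, f x `^ z * g y `^ (1 - z) <= h (z *: x + (1 - z) *: y)%R) ->
  partial f x `^ z * partial g y `^ (1 - z) <= partial h (z *: x + (1 - z) *: y)%R.
Proof.
move=> z01 uf ug uh lf lg fgh; apply: plW => //.
- exact: unit_section.
- exact: unit_section.
- exact: unit_section.
- exact: log_concave_section.
- exact: log_concave_section.
- by move=> a b; rewrite Phi_affine; exact: fgh.
Qed.

Hypothesis plQ : prekopa_leindler Q.

Lemma prekopa_leindler_affine_image : prekopa_leindler (distribution (Q \x W) Phi).
Proof.
move=> z f g h z01 uf ug uh lf lg fgh.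
have intE k : unit_measurable k ->
    \int[distribution (Q \x W) Phi]_x k x = \int[Q]_x partial k x.
  move=> [mk k01]; have k0 x : 0 <= k x by case/andP: (k01 x).
  rewrite ge0_integral_distribution// fubini_tonelli1//.
    exact: measurableT_comp.
  by move=> xa; exact: k0.
rewrite !intE//; apply: plQ => //; try exact: partial_unit.
(* With three equal functions, the inequality says that integrating out a variable preserves
   log-concavity. *)
- by move=> t x y t01; apply: partial_prekopa_leindler => // a b; exact: lf.
- by move=> t x y t01; apply: partial_prekopa_leindler => // a b; exact: lg.
- by move=> x y; exact: partial_prekopa_leindler.
Qed.

End affine_image.
End prekopa_leindler_transfer.

(** * Measures on products and the one-step map *)

Section affine_step.
Context {R : realType}.

(** Rectangles form a pi-system that generates the product sigma-algebra and contains the whole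
    space, whose measure is finite. *)
Lemma eq_measure_rectangles d1 d2 (T1 : measurableType d1) (T2 : measurableType d2)
    (m1 m2 : {measure set (T1 * T2) -> \bar R}) :
  (m1 setT < +oo)%E ->
  (forall A B, measurable A -> measurable B -> m1 (A `*` B) = m2 (A `*` B)) ->
  forall E, measurable E -> m1 E = m2 E.
Proof.
move=> m1oo m12; pose G := [set C : set (T1 * T2) |
  exists A, measurable A /\ exists B, measurable B /\ C = A `*` B].
apply: (measure_unique G (fun=> setT)) => //.
- rewrite measurable_prod_measurableType //; congr (<<s _ >>).
  rewrite predeqE; split => [[A mA [B mB <-]]|[A [mA [B [mB ->]]]]].
    by exists A; split => //; exists B.
  by exists A => //; exists B.
- move=> _ _ [X1 [mX1 [X2 [mX2 ->]]]] [Y1 [mY1 [Y2 [mY2 ->]]]].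
  rewrite -setXI; exists (X1 `&` Y1); split; first exact: measurableI.
  by exists (X2 `&` Y2); split => //; exact: measurableI.
- by move=> _; exists setT; split => //; exists setT; split => //; rewrite setXTT.
- by rewrite bigcup_const//; exists 0%N.
- by move=> _ [A1 [mA1 [A2 [mA2 ->]]]]; exact: m12.
Qed.

Context (n p : nat).
Variables (A : 'M[R]_n) (b : 'cV[R]_n) (F : 'M[R]_(n, p)).

Definition affine_step (za : 'cV[R]_n * 'cV[R]_p) : 'cV[R]_n :=
  A *m za.1 + b + F *m za.2.

Lemma measurable_affine_step : measurable_fun setT affine_step.
Proof.
apply: measurable_fun_mx => i j.
rewrite (_ : (fun t => _) = (fun za : 'cV[R]_n * 'cV[R]_p =>
    \sum_k A i k * za.1 k j + b i j + \sum_k F i k * za.2 k j)); last first.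
  by apply/funext => za; rewrite /affine_step !mxE.
apply: measurable_funD; first apply: measurable_funD => //.
- apply: measurable_sum => k; apply: measurable_funM => //.
  by apply: (measurableT_comp (measurable_coord_mx k j)); exact: measurable_fst.
- apply: measurable_sum => k; apply: measurable_funM => //.
  by apply: (measurableT_comp (measurable_coord_mx k j)); exact: measurable_snd.
Qed.

HB.instance Definition _ :=
  isMeasurableFun.Build _ _ _ _ affine_step measurable_affine_step.

Lemma affine_stepE (z : R) x y a c :
  affine_step (z *: x + (1 - z) *: y, z *: a + (1 - z) *: c) =
  z *: affine_step (x, a) + (1 - z) *: affine_step (y, c).
Proof.
rewrite /affine_step /= !mulmxDr -!scalemxAr !scalerDr.
rewrite [RHS]addrACA; congr (_ + _); rewrite [RHS]addrACA; congr (_ + _).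
by rewrite -scalerDl addrC subrK scale1r.
Qed.

End affine_step.

(** * Independence of the state from future disturbances *)

Section dpv_law.
Context {R : realType} (N n p : nat) d (T : measurableType d) (P : probability T R).
Variables (w : 'I_N -> {RV P >-> 'cV[R]_p}) (Pw : probability 'cV[R]_p R).
Hypothesis w_iid : iid_with_law w Pw.
Local Open Scope ereal_scope.

Definition noise_event (J : {set 'I_N}) (S : 'I_N -> set 'cV[R]_p) : set T :=
  \bigcap_(i in [set` J]) (w i @^-1` S i).

(* Taking J empty, Q is the law of X. *)
Definition independent_of_future (X : T -> 'cV[R]_n) (Q : probability 'cV[R]_n R)
    (t : nat) :=
  forall C (J : {set 'I_N}) S, measurable C ->
    (forall i, i \in J -> measurable (S i)) ->
    (forall i, i \in J -> (t <= i)%N) ->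
    P (X @^-1` C `&` noise_event J S) = Q C * \prod_(i in J) Pw (S i).

Lemma measurable_noise_event (J : {set 'I_N}) S :
  (forall i, i \in J -> measurable (S i)) -> measurable (noise_event J S).
Proof.
move=> mS; apply: fin_bigcap_measurable; first exact: finite_finpred.
move=> i /= iJ; rewrite -[X in measurable X]setTI.
exact: (measurable_funPT (w i) measurableT _ (mS i iJ)).
Qed.

Lemma independent_of_future_cst x0 t :
  independent_of_future (fun=> x0) (\d_ x0) t.
Proof.
move=> C J S mC mS _; rewrite /= diracE.
have [xC|xC] := boolP (x0 \in C); last first.
  rewrite preimage_cst (negbTE xC) set0I measure0 mul0e//.
rewrite preimage_cst xC setTI mul1e /noise_event (w_iid.1 J S mS).
by apply: eq_bigr => i iJ; rewrite -(w_iid.2 i _ (mS i iJ)).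
Qed.

(** The joint law of [X] and [w t], restricted to the noise event, is [Q \x Pw] scaled by the
    product of the [Pw (S i)]; it suffices to compare the two on rectangles. *)
Lemma independent_of_future_step (X : T -> 'cV[R]_n) (Q : probability 'cV[R]_n R)
    (t : 'I_N) (Phi : {mfun ('cV[R]_n * 'cV[R]_p)%type >-> 'cV[R]_n}) :
  measurable_fun setT X -> independent_of_future X Q t ->
  independent_of_future (fun omega => Phi (X omega, w t omega))
    (distribution (Q \x Pw) Phi) t.+1.
Proof.
move=> mX indX C J S mC mS Jt.
pose Xw omega := (X omega, w t omega).
have mXw : measurable_fun setT Xw by exact/measurable_fun_pair.
have mW := measurable_noise_event mS.
have c0 : (0 <= fine (\prod_(i in J) Pw (S i)))%R.
  by rewrite fine_ge0// prode_ge0.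
have cE : \prod_(i in J) Pw (S i) = (fine (\prod_(i in J) Pw (S i)))%:E.
  rewrite fineK//; apply: prode_fin_num => i iJ.
  by rewrite fin_num_measure//; exact: mS.
have := @eq_measure_rectangles R _ _ _ _ (pushforward (mrestr P mW) Xw)
  (mscale (NngNum c0) (Q \x Pw)).
have tJ : t \notin J by apply/negP => /Jt; rewrite ltnn.
have fin1 : (pushforward (mrestr P mW) Xw setT < +oo).
  rewrite /pushforward preimage_setT /mrestr setTI.
  by apply: le_lt_trans (probability_le1 P mW) _; rewrite ltry.
have rect D E : measurable D -> measurable E ->
    pushforward (mrestr P mW) Xw (D `*` E) =
    mscale (NngNum c0) (Q \x Pw) (D `*` E).
  move=> mD mE; rewrite /pushforward /mrestr /mscale/= -cE product_measure1E//.
  (* On a rectangle the condition on [w t] becomes one more noise constraint: [indX] admits the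
     index [t], which is new because [J] starts at [t.+1]. *)
  pose S' i := if i == t then E else S i.
  have -> : Xw @^-1` (D `*` E) `&` noise_event J S =
      X @^-1` D `&` noise_event (t |: J) S'.
    apply/seteqP; split => omega /=.
      move=> [[/= XD wE] JS]; split => // i; rewrite /= in_setU1 /S'.
      by case: eqVneq => [-> _//|_ /= iJ]; exact: JS.
    move=> [XD JS]; split; first split => //=.
      by have := JS t; rewrite /S' eqxx; apply; rewrite /= setU11.
    move=> i /= iJ; have := JS i; rewrite /S' ifN; last first.
      by apply: contraNneq tJ => <-.
    by apply; rewrite /= in_setU1 iJ orbT.
  rewrite indX//; last 2 first.
  - move=> i; rewrite in_setU1 /S'; case: eqVneq => //= _; exact: mS.
  - move=> i; rewrite in_setU1 => /orP[/eqP->//|/Jt]; exact: ltnW.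
  rewrite big_setU1//= {1}/S' eqxx muleA [RHS]muleC.
  congr (_ * _); apply: eq_bigr => i iJ; rewrite /S' ifN//.
  by apply: contraNneq tJ => <-.
have mE : measurable (Phi @^-1` C).
  by rewrite -[X in measurable X]setTI; exact: (measurable_funPT Phi).
move=> /(_ mXw fin1 rect _ mE) e; rewrite cE [RHS]muleC; exact: e.
Qed.

End dpv_law.

(** * Convexity and compactness of the occupied set *)

Section occupied_set.
Context {R : realType} (n : nat).
Implicit Types (K : set 'cV[R]_n) (Q : probability 'cV[R]_n R).

(** The set [y - K]; for [K] the shape at the origin, these are the centres whose obstacle covers
    [y]. *)
Definition reflected_translate K (y : 'cV[R]_n) := [set z | K (y - z)].

Lemma closed_reflected_translate K y : closed K -> closed (reflected_translate K y).
Proof.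
move=> cK; apply: (proj1 (continuous_closedP (fun z : 'cV[R]_n => y - z))) cK.
move=> z; apply/(@cvg_ballP _ _ _ (nbhs z)) => e e0; near=> z'.
have : ball z e z' by near: z'; exact: nbhsx_ballx.
rewrite -!ball_normE /= distrC.
by have -> : y - z - (y - z') = z' - z by rewrite opprB addrC addrA subrK.
Unshelve. all: by end_near. Qed.

Lemma closed_measurable_mx (C : set 'cV[R]_n) : closed C -> measurable C.
Proof.
move=> cC; rewrite -[C]setCK; apply: measurableC; apply: open_measurable_mx.
exact: closed_openC.
Qed.

Lemma unit_measurable_indic (C : set 'cV[R]_n) : measurable C ->
  unit_measurable (fun x => (\1_C x)%:E).
Proof.
move=> mC; split; first exact/measurable_EFinP/measurable_indic.
by move=> x; rewrite indicE; case: (_ \in _); rewrite !lee_fin ler01 lexx.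
Qed.

(** Both exponents are positive and so send [0] to [0]: the left side is [1] when [x] is in [A] and
    [y] in [B], and [0] otherwise. *)
Lemma indic_geometric_le (A B C : set 'cV[R]_n) (z : R) x y : 0 < z < 1 ->
  (A x -> B y -> C (z *: x + (1 - z) *: y)) ->
  ((\1_A x)%:E `^ z * (\1_B y)%:E `^ (1 - z) <=
   (\1_C (z *: x + (1 - z) *: y))%:E)%E.
Proof.
move=> /andP[z0 z1] ABC; have z1' : 0 < 1 - z by rewrite subr_gt0.
rewrite !indicE; case: (boolP (x \in A)) => [/set_mem Ax|_]; last first.
  by rewrite poweR0r ?gt_eqF// mul0e lee_fin.
case: (boolP (y \in B)) => [/set_mem By|_]; last first.
  by rewrite [X in (_ * X)%E]poweR0r ?gt_eqF// mule0 lee_fin.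
rewrite mem_set; last exact: ABC.
change (1%:E `^ z * 1%:E `^ (1 - z) <= 1%:E :> \bar R)%E.
by rewrite !poweR1r mule1.
Qed.

(** For convex [K], combinations of points of [x - K] and [y - K] lie in the translate at the
    combined point, so the inequality applies to the three indicators; [alpha] is its own geometric
    mean. *)
Lemma convex_occupied Q K (alpha : R) : 0 < alpha -> prekopa_leindler Q ->
  closed K -> @convex_set R 'cV[R]_n K ->
  @convex_set R 'cV[R]_n [set y | (alpha%:E <= Q (reflected_translate K y))%E].
Proof.
move=> a0 plQ cK vK; apply/convex_setW => x y; rewrite !inE/= => ax ay k k0 k1.
have z01 : 0 < k%:num < 1 by rewrite k0 k1.
have mS v : measurable (reflected_translate K v).
  by apply: closed_measurable_mx; exact: closed_reflected_translate.
have comb (z : R) v1 v2 z1 z2 : 0 < z < 1 ->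
    reflected_translate K v1 z1 -> reflected_translate K v2 z2 ->
    reflected_translate K (z *: v1 + (1 - z) *: v2) (z *: z1 + (1 - z) *: z2).
  rewrite /reflected_translate /= => /andP[t0 t1] K1 K2.
  have z01' : 0 <= z <= 1 by rewrite (ltW t0) (ltW t1).
  have -> : z *: v1 + (1 - z) *: v2 - (z *: z1 + (1 - z) *: z2) =
      z *: (v1 - z1) + (1 - z) *: (v2 - z2).
    by rewrite !scalerBr opprD addrACA.
  have /andP[zz0 zz1] := z01'.
  have := vK (v1 - z1) (v2 - z2) (Itv01 zz0 zz1).
  by rewrite !inE; exact.
rewrite inE /=.
change (alpha%:E <=
  Q (reflected_translate K (k%:num *: x + (1 - k%:num) *: y)))%E.
have intE v : Q (reflected_translate K v) =
    (\int[Q]_z (\1_(reflected_translate K v) z)%:E)%E.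
  by rewrite integral_indic// setIT.
rewrite !intE in ax ay *.
have := plQ k%:num _ _ _ z01 (unit_measurable_indic (mS x))
  (unit_measurable_indic (mS y))
  (unit_measurable_indic (mS (k%:num *: x + (1 - k%:num) *: y))).
have lc v : log_concave_fun (fun z => (\1_(reflected_translate K v) z)%:E).
  move=> t z1 z2 t01; apply: indic_geometric_le => // S1 S2.
  have -> : v = t *: v + (1 - t) *: v by rewrite -scalerDl addrC subrK scale1r.
  exact: comb.
move=> /(_ (lc x) (lc y)) H; apply: (le_trans _ (H _)); last first.
  by move=> z1 z2; apply: indic_geometric_le => // S1 S2; exact: comb.
have a0' : (0 <= alpha%:E)%E by rewrite lee_fin ltW.
rewrite -[leLHS](geometric_id z01 a0').
exact: lee_geometric.
Qed.

(** Compactness of a product of segments, stated for row vectors, is carried over by the continuous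
    transpose. *)
Lemma compact_box_cV (M : R) : compact [set v : 'cV[R]_n | forall i, `|v i ord0| <= M].
Proof.
rewrite (_ : mkset _ = trmx @`
  [set v : 'rV[R]_n | forall i, `[- M, M]%classic (v ord0 i)]).
  apply: continuous_compact; last first.
    by apply: (@rV_compact _ _ (fun=> `[- M, M]%classic)) => _; exact: segment_compact.
  apply: continuous_subspaceT => v; apply/(@cvg_ballP _ _ _ (nbhs v)) => e e0.
  near=> v'; have [_ vv'] : ball v e v' by near: v'; exact: nbhsx_ballx.
  by split=> // i j; rewrite !mxE.
apply/seteqP; split=> [v vM|_ [v vM <-] i].
  by exists v^T; rewrite ?trmxK// => i /=; rewrite mxE in_itv/= -ler_norml.
by have := vM i; rewrite /= in_itv/= -ler_norml mxE.
Unshelve. all: by end_near. Qed.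

Lemma compact_occupied Q K (alpha : R) : 0 < alpha -> compact K ->
  compact [set y | (alpha%:E <= Q (reflected_translate K y))%E].
Proof.
move=> a0 kK.
have cK : closed K by apply: compact_closed kK; exact: norm_hausdorff.
have mS v : measurable (reflected_translate K v).
  by apply: closed_measurable_mx; exact: closed_reflected_translate.
have invS_lt (e : R) : 0 < e -> exists k, k.+1%:R^-1 < e.
  move=> e0; have [k _ ke] := near_infty_natSinv_lt (PosNum e0).
  by exists k; exact: (ke k (leqnn k)).
have leS (j k : nat) : (j <= k)%N -> k.+1%:R^-1 <= j.+1%:R^-1 :> R.
  by move=> jk; rewrite lef_pV2 ?posrE// ler_nat.
have clA : closed [set y | (alpha%:E <= Q (reflected_translate K y))%E].
  (* [E k] is the open neighbourhood of [y - K] of radius [1/(k+1)]. It contains [y' - K] for every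
     [y'] that close to [y], and the intersection of all [E k] lies in [y - K] because [K] is
     closed. *)
  move=> y yA; pose E k := \bigcup_(c in K) ball (y - c) k.+1%:R^-1.
  have mE k : measurable (E k).
    by apply: open_measurable_mx; apply: bigcup_open => c _; exact: ball_open.
  have EQ : \bigcap_k E k `<=` reflected_translate K y.
    move=> z zE; apply: cK => B /nbhs_ballP[e /= e0 eB].
    have [k ke] := invS_lt e e0; have [c Kc yz] := zE k I.
    exists c; split => //; apply: eB; apply: (le_ball (ltW ke)).
    move: yz; rewrite -!ball_normE /=.
    by rewrite addrAC.
  have aE k : (alpha%:E <= Q (E k))%E.
    have [|y' [/= ay' yy']] := yA (ball y k.+1%:R^-1).
      by apply: nbhsx_ballx; rewrite invr_gt0.
    apply: (le_trans ay'); apply: le_measure; rewrite ?inE// => z Kz.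
    exists (y' - z) => //; move: yy'; rewrite -!ball_normE /=.
    by have -> : y - (y' - z) - z = y - y' by rewrite opprB addrA addrAC addrK.
  apply: (@le_trans _ _ (Q (\bigcap_k E k))); last first.
    by apply: le_measure; rewrite ?inE//; exact: bigcapT_measurable.
  apply: (@cvge_ge nat \oo _ R (Q \o E)); first by apply: nearW => k; exact: aE.
  apply: nonincreasing_cvg_mu => //.
  - by apply: (le_lt_trans (probability_le1 Q (mE _))); exact: ltry.
  - exact: bigcapT_measurable.
  - move=> j k jk; apply/subsetPset => z [c Kc yz]; exists c => //.
    exact: le_ball (leS _ _ jk) _ yz.
pose B k : set 'cV[R]_n := ~` ball 0 k%:R.
have mB k : measurable (B k).
  by apply: measurableC; apply: open_measurable_mx; exact: ball_open.
have B0 : \bigcap_k B k = set0.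
  apply/seteqP; split => // z zB; have := zB (Num.truncn `|z|).+1 I; apply.
  by rewrite -ball_normE /= sub0r normrN truncnS_gt.
have QB : Q \o B @ \oo --> 0%E.
  rewrite -(measure0 Q) -B0; apply: nonincreasing_cvg_mu => //.
  - by apply: (le_lt_trans (probability_le1 Q (mB _))); exact: ltry.
  - exact: bigcapT_measurable.
  - move=> j k jk; apply/subsetPset => z; apply: contra_not.
    by apply: le_ball; rewrite ler_nat.
(* The tails of [Q] tend to [0], hence fall below the positive number [alpha]. *)
have [k Bk] : exists k, (Q (B k) < alpha%:E)%E.
  apply/not_existsP => H.
  have : (alpha%:E <= 0)%E.
    apply: (@cvge_ge nat \oo _ R (Q \o B) _ _ _ QB); apply: nearW => k /=.
    by rewrite leNgt; apply/negP; exact: H.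
  by rewrite lee_fin leNgt a0.
have [M [_ KM]] := compact_bounded kK.
(* Every number above [M] bounds the norm on [K]: [|M| + 1] is one, and a further unit gives the
   strict inequality of an open ball. *)
have {}KM c : K c -> forall i, `|c i ord0| <= `|M| + 2.
  move=> Kc i; have [_ /(_ i ord0)] : ball (0 : 'cV[R]_n) (`|M| + 2) c.
    rewrite -ball_normE /= sub0r normrN.
    apply: (le_lt_trans (KM (`|M| + 1) _ c Kc)); last by rewrite ltrD2l ltr1n.
    by rewrite (le_lt_trans (ler_norm M))// ltrDl.
  by rewrite -ball_normE /= mxE sub0r normrN => /ltW.
apply: subclosed_compact clA (@compact_box_cV (`|M| + 2 + k%:R)) _ => y /= ay i.
(* [y - K] has more mass than the complement of the ball, so it meets the ball at some [z]; then [y]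
   is the sum of [y - z] in [K] and the bounded [z]. *)
have [z [Kz zk]] : exists z, reflected_translate K y z /\ ball 0 k%:R z.
  apply/not_existsP => H; move: ay; apply/negP; rewrite -ltNge.
  apply: le_lt_trans Bk; apply: le_measure; rewrite ?inE// => z Kz zb.
  by apply: (H z).
have -> : y i ord0 = (y - z) i ord0 + z i ord0 by rewrite !mxE subrK.
apply: (le_trans (ler_normD _ _)); apply: lerD; first exact: KM.
by case: zk => _ /(_ i ord0); rewrite -ball_normE /= mxE sub0r normrN => /ltW.
Qed.

End occupied_set.

(** * Laws of the states and conclusion *)

(** Induction on time. Independence from the disturbances of index at least [t] belongs to the
    invariant because it gives the pair of state and next disturbance a product law, whose affine
    image is the next state's law. *)
Lemma dpv_law (R : realType) (N n m p l : nat) (Par : set 'cV[R]_l)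
  (A : Par -> 'M[R]_n) (B : Par -> 'M[R]_(n, m)) (F : Par -> 'M[R]_(n, p))
  d (T : measurableType d) (P : probability T R)
  (x0 : 'cV[R]_n) (lam : 'I_N -> Par) (u : 'I_N -> 'cV[R]_m)
  (w : 'I_N -> {RV P >-> 'cV[R]_p}) (Pw : probability 'cV[R]_p R)
  (x : nat -> T -> 'cV[R]_n) :
  iid_with_law w Pw -> prekopa_leindler Pw ->
  dpv_trajectory A B F x0 lam u (fun t => w t : T -> 'cV[R]_p) x ->
  forall t, (t <= N)%N -> exists Q : probability 'cV[R]_n R,
    [/\ prekopa_leindler Q, measurable_fun setT (x t) &
        independent_of_future w Pw (x t) Q t].
Proof.
move=> w_iid plPw [x_0 x_S]; elim=> [_|t IHt tN].
  have -> : x 0%N = fun=> x0 by apply/funext => omega; exact: x_0.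
  exists (\d_ x0); split; first exact: prekopa_leindler_dirac.
    exact: measurable_cst.
  exact: independent_of_future_cst.
have [Q [plQ mx indx]] := IHt (ltnW tN); pose i := Ordinal tN.
pose Phi : {mfun ('cV[R]_n * 'cV[R]_p)%type >-> 'cV[R]_n} :=
  affine_step (A (lam i)) (B (lam i) *m u i) (F (lam i)).
have xE : x t.+1 = fun omega => Phi (x t omega, w i omega).
  by apply/funext => omega; exact: (x_S i omega).
exists (distribution (Q \x Pw)%E Phi); split.
- by apply: prekopa_leindler_affine_image => // z y1 y2 a b; exact: affine_stepE.
- rewrite xE; apply: (measurableT_comp (measurable_funPT Phi)).
  by apply/measurable_fun_pair.
- by rewrite xE; exact: (@independent_of_future_step _ _ _ _ _ _ _ _ _ _ _ i).
Qed.

Theorem theorem5 (R : realType) (N n m p l : nat)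
  (N_gt0 : (0 < N)%N) (n_gt0 : (0 < n)%N) (m_gt0 : (0 < m)%N)
  (p_gt0 : (0 < p)%N) (l_gt0 : (0 < l)%N)
  (Par : set 'cV[R]_l) (Par_finite : finite_set Par)
  (A : Par -> 'M[R]_n) (B : Par -> 'M[R]_(n, m)) (F : Par -> 'M[R]_(n, p))
  (d : measure_display) (T : measurableType d) (P : probability T R)
  (x0 : 'cV[R]_n) (lam : 'I_N -> Par) (u : 'I_N -> 'cV[R]_m)
  (w : 'I_N -> {RV P >-> 'cV[R]_p}) (Pw : probability 'cV[R]_p R)
  (w_iid : iid_with_law w Pw) (Pw_density : has_density Pw)
  (x : nat -> T -> 'cV[R]_n)
  (x_dpv : dpv_trajectory A B F x0 lam u (fun t => w t : T -> 'cV[R]_p) x)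
  (h_obs : 'cV[R]_n -> R) (h_obs_borel : measurable_fun setT h_obs)
  (shape_borel : measurable (obstacle h_obs 0))
  (shape_nonnull : lebesgue_cV (obstacle h_obs 0) != 0%E)
  (Pw_log_concave : log_concave Pw)
  (shape_convex : @convex_set R 'cV[R]_n (obstacle h_obs 0))
  (shape_compact : compact (obstacle h_obs 0))
  (alpha : R) (alpha_gt0 : 0 < alpha) (tau : nat) (tau_range : (1 <= tau <= N)%N) :
  @convex_set R 'cV[R]_n (PrOccupySet P h_obs x alpha tau) /\
  compact (PrOccupySet P h_obs x alpha tau).
Proof.
have plPw := log_concave_prekopa_leindler Pw_log_concave.
have [_ tauN] := andP tau_range.
have [Q [plQ mx indx]] := dpv_law w_iid plPw x_dpv tauN.
have cK : closed (obstacle h_obs 0).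
  by apply: compact_closed shape_compact; exact: norm_hausdorff.
have -> : PrOccupySet P h_obs x alpha tau =
    [set y | (alpha%:E <= Q (reflected_translate (obstacle h_obs 0) y))%E].
  apply/funext => y; rewrite /PrOccupySet /occupancy /=.
  have -> : [set z | obstacle h_obs z y] = reflected_translate (obstacle h_obs 0) y.
    by apply/funext => z; rewrite /obstacle /reflected_translate /= subr0.
  (* With no disturbance constrained, the noise event is the whole space and the product is [1], so
     [Q] is seen to be the law of the state. *)
  have := indx (reflected_translate (obstacle h_obs 0) y) (finset.set0) (fun=> setT).
  rewrite /noise_event big_set0 mule1 => <-; last 3 first.
  - by apply: closed_measurable_mx; exact: closed_reflected_translate.
  - by move=> i; rewrite inE.
  - by move=> i; rewrite inE.
  rewrite (_ : \bigcap_(i in _) _ = setT) ?setIT//.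
  by apply/seteqP; split => // omega _ i /=; rewrite inE.
split; [exact: convex_occupied|exact: compact_occupied].
Qed.
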